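(* Let $m,n\ge1$, $l=\gcd(m,n)$, $L=\operatorname{lcm}(m,n)$, and let $G=\mathbb{Z}_m\times\mathbb{Z}_n$ with the $\mathbb{Z}_n$ factor generated by $\mathbf g$ and the $\mathbb{Z}_m$ factor generated by $\mathbf h$. Let $\mathcal{C}_G^\times$ be a $G$-crossed braided tensor category extending a unitary modular tensor category $\mathcal{C}_{\mathbf 0}$, such that $G$ does not permute the anyons and there is no mixed symmetry fractionalization, and choose Abelian defects $0_{\mathbf g},0_{\mathbf h},0_{\mathbf{gh}}$ with $0_{\mathbf g}\times0_{\mathbf h}=0_{\mathbf{gh}}$. Let $p=(0_{\mathbf g})^n\in\mathcal{A}$ and $q=(0_{\mathbf h})^m\in\mathcal{A}$. Then $$\left(\frac{\mathcal{I}_L(0_{\mathbf{gh}})}{\mathcal{I}_m(0_{\mathbf h})^{n/l}\,\mathcal{I}_n(0_{\mathbf g})^{m/l}}\right)^{L}=M_{p,q}^{L/l},$$ and moreover there is an integer $k\in\mathbb{Z}_l$ such that $$\frac{\mathcal{I}_L(0_{\mathbf{gh}})}{\mathcal{I}_m(0_{\mathbf h})^{n/l}\,\mathcal{I}_n(0_{\mathbf g})^{m/l}}=e^{2\pi i\frac{p\star q+k}{l}} .$$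
   Context: $\mathcal{C}_{\mathbf 0}$ is a unitary modular tensor category (its simple objects are ''anyons''); $\mathcal{A}$ is the finite Abelian group of Abelian (quantum dimension 1) anyons under fusion; $M_{a,b}=R^{a,b}R^{b,a}$ for $b\in\mathcal{A}$; $p\star q\in[0,1)$ is defined by $e^{2\pi i\,p\star q}=M_{p,q}$; $\theta_a$ is the topological twist ($\theta_a=R^{a,a}$ for Abelian anyons and Abelian defects). $\mathbf 0$ denotes the identity of $G$, $\bar{\mathbf g}=\mathbf g^{-1}$. For an Abelian defect $0_{\mathbf k}$ with $\mathbf k^N=\mathbf 0$: $\mathcal{I}_N(0_{\mathbf k})=\theta_{0_{\mathbf k}}^N\prod_{j=0}^{N-1}\eta_{0_{\mathbf k}}(\mathbf k,\mathbf k^j)$. A $G$-crossed braided tensor category (BTC) $\mathcal{C}_G^\times=\bigoplus_{\mathbf g\in G}\mathcal{C}_{\mathbf g}$ is a $G$-graded unitary fusion-type category with trivial component $\mathcal{C}_{\mathbf 0}$, a $G$-action $x\mapsto{}^{\mathbf k}x$ mapping $\mathcal{C}_{\mathbf g}\to\mathcal{C}_{\mathbf{kgk}^{-1}}$, and a $G$-crossed braiding ($c_{\mathbf k}\times a_{\mathbf g}={}^{\mathbf k}a_{\mathbf g}\times c_{\mathbf k}$). Simple objects of $\mathcal{C}_{\mathbf g}$ are called $\mathbf g$-defects; a defect is Abelian if it has quantum dimension 1. Skeletally it is given by data $\{F,R,U,\eta\}$: $F$-symbols satisfying the pentagon equation; $G$-crossed $R$-symbols; phases/matrices $U_{\mathbf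 k}(a,b;c)$ for the action of $\mathbf k$ on splitting spaces; phases $\eta_x(\mathbf g,\mathbf h)$ relating the action of $\mathbf{gh}$ to the composition of the actions, with $U_{\mathbf 0}=1$, $\eta_0=1$, $\eta_x(\mathbf g,\mathbf 0)=\eta_x(\mathbf 0,\mathbf h)=1$. For Abelian objects subscripts are dropped, and for $a\in\mathcal{C}_{\mathbf g},b\in\mathcal{C}_{\mathbf h},c\in\mathcal{C}_{\mathbf k}$ the consistency equations read $R^{a,c}F^{a,c,{}^{\bar{\mathbf k}}b}R^{b,c}=F^{c,{}^{\bar{\mathbf k}}a,{}^{\bar{\mathbf k}}b}\,U_{\mathbf k}(a,b)\,R^{ab,c}F^{a,b,c}$, $(R^{c,a})^{-1}F^{a,{}^{\bar{\mathbf g}}c,b}(R^{{}^{\bar{\mathbf g}}c,b})^{-1}=F^{c,a,b}\,\eta_c(\mathbf g,\mathbf h)\,(R^{c,ab})^{-1}F^{a,b,{}^{\bar{\mathbf h}\bar{\mathbf g}}c}$, $\eta_x(\mathbf g,\mathbf h)\eta_x(\mathbf{gh},\mathbf k)=\eta_{{}^{\bar{\mathbf g}}x}(\mathbf h,\mathbf k)\eta_x(\mathbf g,\mathbf{hk})$, $\eta_a(\mathbf k,\mathbf l)\eta_b(\mathbf k,\mathbf l)U_{\mathbf l}({}^{\bar{\mathbf k}}a,{}^{\bar{\mathbf k}}b)U_{\mathbf k}(a,b)=U_{\mathbf{kl}}(a,b)\eta_{ab}(\mathbf k,\mathbf l)$, and the $G$-crossed ribbon property $R^{b,{}^{\bar{\mathbf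 h}}a}R^{a,b}=\frac{\theta_{ab}}{\theta_a\theta_b}\frac{U_{\mathbf{gh}}(a,b)}{\eta_a(\mathbf g,\mathbf h)\eta_b(\mathbf h,\bar{\mathbf h}\mathbf{gh})}$. Since $G$ acts trivially on anyons, each $\mathcal{C}_{\mathbf k}$ contains an Abelian defect, and once one, $0_{\mathbf k}$, is chosen for each $\mathbf k$ ($0_{\mathbf 0}$ trivial), $0_{\mathbf k}\times0_{\mathbf l}=\mathfrak{w}(\mathbf k,\mathbf l)\times0_{\mathbf{kl}}$ with $\mathfrak{w}$ an $\mathcal{A}$-valued 2-cocycle whose class in $\mathcal{H}^2(G,\mathcal{A})$ is the symmetry fractionalization class. ''No mixed symmetry fractionalization'' means that this class is a product of pullbacks of classes in $\mathcal{H}^2(\mathbb{Z}_m,\mathcal{A})$ and $\mathcal{H}^2(\mathbb{Z}_n,\mathcal{A})$ along the two projections (so that in particular the choice $0_{\mathbf g}\times0_{\mathbf h}=0_{\mathbf{gh}}$ is possible). *)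

(* Defs.v *)
From HB Require Import structures.
From mathcomp Require Import all_boot all_order all_algebra all_fingroup.
From mathcomp Require Import all_classical all_reals all_analysis.
From mathcomp Require Import complex.

Set Implicit Arguments.
Unset Strict Implicit.
Unset Printing Implicit Defensive.

Import Order.TTheory GRing.Theory Num.Theory.
Local Open Scope ring_scope.

(* cis x = e^{2 pi i x} *)
Definition cis {R : realType} (x : R) : R[i] :=
  (cos (2 * pi * x) +i* sin (2 * pi * x))%C.

Definition kron {R : realType} (b : bool) : R[i] := b%:R.

(* The array (A i j), i < m, j < n, has orthonormal rows and columns. *)
Definition unitary_array {R : realType} (m n : nat) (A : nat -> nat -> R[i])
  : Prop :=
  (forall i i', (i < m)%N -> (i' < m)%N ->
     \sum_(j < n) A i j * (A i' j)^* = kron (i == i')) /\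
  (forall j j', (j < n)%N -> (j' < n)%N ->
     \sum_(i < m) (A i j)^* * A i j' = kron (j == j')).

(* Skeletal data over a group G.  [lab] is the set of (isomorphism classes of)
   simple objects, and the splitting space V^{ab}_c has a chosen orthonormal
   basis |a,b;c,mu> indexed by mu < Nfus a b c.  Basis indices are plain natural
   numbers, so that no casts are needed between spaces whose dimensions are
   only provably equal; values at out-of-range indices are irrelevant.
   Conventions, for a in C_g and b in C_h:
   - F-move: |a,b;e,al> |e,c;d,be>
       = sum_{f,mu,nu} (Fs a b c d e al be f mu nu) |b,c;f,mu> |a,f;d,nu>;
   - Rs a b c mu nu are the entries of R^{ab}_c from V^{b, h^-1.a}_c
     (index mu) to V^{ab}_c (index nu);
   - Us k a b c mu nu are the entries of U_k(a,b;c) from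
     V^{k^-1.a, k^-1.b}_{k^-1.c} (index mu) to V^{ab}_c (index nu). *)
Record gcross_data (R : realType) (G : finGroupType) := GcrossData {
  lab :> finType;
  vac : lab;
  dobj : lab -> lab;
  sector : lab -> G;
  gact : G -> lab -> lab;
  Nfus : lab -> lab -> lab -> nat;
  qdim : lab -> R;
  Fs : lab -> lab -> lab -> lab ->
       lab -> nat -> nat -> lab -> nat -> nat -> R[i];
  Rs : lab -> lab -> lab -> nat -> nat -> R[i];
  Us : G -> lab -> lab -> lab -> nat -> nat -> R[i];
  eta : lab -> G -> G -> R[i]
}.

Section Theory.
Variables (R : realType) (G : finGroupType) (D : gcross_data R G).
Implicit Types (a b c d e f x : D) (g h k l : G).

(* [bact k x] is the action of k^-1 on x. *)
Definition bact k x : D := gact k^-1%g x.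

(* Inverse of R^{ab}_c, from V^{ab}_c (index mu) to V^{b, h^-1.a}_c; it is the
   adjoint because R is unitary. *)
Definition Rinv a b c (mu nu : nat) : R[i] := (Rs a b c nu mu)^*.

(* Topological twist: theta_a = sum_c (d_c / d_a) tr R^{aa}_c.  The trace makes
   sense because a in C_g is fixed by g. *)
Definition theta a : R[i] :=
  \sum_(c : D) \sum_(mu < Nfus a a c) (qdim c / qdim a)%:C%C * Rs a a c mu mu.

Definition fusion_axioms : Prop :=
  (forall a c, Nfus a (vac D) c = (a == c)) /\
  (forall b c, Nfus (vac D) b c = (b == c)) /\
  (forall a b, Nfus a b (vac D) = (b == dobj a)) /\
  (forall a, dobj (dobj a) = a) /\
  (forall a b c, Nfus (dobj b) (dobj a) (dobj c) = Nfus a b c) /\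
  (forall a b c d,
     (\sum_(e : D) Nfus a b e * Nfus e c d
      = \sum_(f : D) Nfus b c f * Nfus a f d)%N).

(* Positivity and multiplicativity determine qdim (Perron-Frobenius). *)
Definition qdim_axioms : Prop :=
  (forall a, 0 < qdim a) /\
  qdim (vac D) = 1 /\
  (forall a, qdim (dobj a) = qdim a) /\
  (forall a b, qdim a * qdim b = \sum_(c : D) (Nfus a b c)%:R * qdim c) /\
  (forall a, `|Fs a (dobj a) a a (vac D) 0%N 0%N (vac D) 0%N 0%N|
             = ((qdim a)^-1)%:C%C).

Definition grading_axioms : Prop :=
  (forall k, exists a, sector a = k) /\
  (forall a b c, (0 < Nfus a b c)%N -> sector c = (sector a * sector b)%g) /\
  (forall a, gact 1%g a = a) /\
  (forall k l a, gact (k * l)%g a = gact k (gact l a)) /\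
  (forall k, gact k (vac D) = vac D) /\
  (forall k a, sector (gact k a) = (k * sector a * k^-1)%g) /\
  (forall k a b c, Nfus (gact k a) (gact k b) (gact k c) = Nfus a b c) /\
  (forall a b c, Nfus a b c = Nfus b (bact (sector b) a) c).

Definition F_unitary : Prop :=
  (forall a b c d e (al be : nat) e' (al' be' : nat),
     (al < Nfus a b e)%N -> (be < Nfus e c d)%N ->
     (al' < Nfus a b e')%N -> (be' < Nfus e' c d)%N ->
     \sum_(f : D) \sum_(mu < Nfus b c f) \sum_(nu < Nfus a f d)
        Fs a b c d e al be f mu nu * (Fs a b c d e' al' be' f mu nu)^*
     = kron [&& e == e', al == al' & be == be']) /\
  (forall a b c d f (mu nu : nat) f' (mu' nu' : nat),
     (mu < Nfus b c f)%N -> (nu < Nfus a f d)%N ->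
     (mu' < Nfus b c f')%N -> (nu' < Nfus a f' d)%N ->
     \sum_(e : D) \sum_(al < Nfus a b e) \sum_(be < Nfus e c d)
        (Fs a b c d e al be f mu nu)^* * Fs a b c d e al be f' mu' nu'
     = kron [&& f == f', mu == mu' & nu == nu']).

Definition unitarity_axioms : Prop :=
  F_unitary /\
  (forall a b c,
     unitary_array (Nfus b (bact (sector b) a) c) (Nfus a b c) (Rs a b c)) /\
  (forall k a b c,
     unitary_array (Nfus (bact k a) (bact k b) (bact k c)) (Nfus a b c)
                   (Us k a b c)) /\
  (forall x g h, `|eta x g h| = 1).

(* Normalization of the symbols involving the vacuum or the identity of G. *)
Definition normalization_axioms : Prop :=
  (forall b c d (mu nu : nat), (mu < Nfus b c d)%N -> (nu < Nfus b c d)%N ->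
     Fs (vac D) b c d b 0 mu d nu 0 = kron (mu == nu)) /\
  (forall a c d (mu nu : nat), (mu < Nfus a c d)%N -> (nu < Nfus a c d)%N ->
     Fs a (vac D) c d a 0 mu c 0 nu = kron (mu == nu)) /\
  (forall a b d (mu nu : nat), (mu < Nfus a b d)%N -> (nu < Nfus a b d)%N ->
     Fs a b (vac D) d d mu 0 b 0 nu = kron (mu == nu)) /\
  (forall a, Rs a (vac D) a 0 0 = 1 /\ Rs (vac D) a a 0 0 = 1) /\
  (forall k a, Us k a (vac D) a 0 0 = 1 /\ Us k (vac D) a a 0 0 = 1) /\
  (forall a b c (mu nu : nat), (mu < Nfus a b c)%N -> (nu < Nfus a b c)%N ->
     Us 1%g a b c mu nu = kron (mu == nu)) /\
  (forall g h, eta (vac D) g h = 1) /\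
  (forall x g, eta x g 1%g = 1 /\ eta x 1%g g = 1).

(* Two ways from |a,b;f,al> |f,c;g,be> |g,d;e,ga>
   to |c,d;l,nu> |b,l;k,mu> |a,k;e,la>. *)
Definition pentagon : Prop :=
  forall (a b c d e f g k l : D) (al be ga nu mu la : nat),
  (al < Nfus a b f)%N -> (be < Nfus f c g)%N -> (ga < Nfus g d e)%N ->
  (nu < Nfus c d l)%N -> (mu < Nfus b l k)%N -> (la < Nfus a k e)%N ->
  \sum_(de < Nfus f l e)
     Fs f c d e g be ga l nu de * Fs a b l e f al de k mu la
  = \sum_(h : D) \sum_(ps < Nfus b c h) \sum_(si < Nfus a h g)
    \sum_(rho < Nfus h d k)
      Fs a b c g f al be h ps si * Fs a h d e g si ga k rho la *
      Fs b c d k h ps rho l nu mu.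

Definition heptagon1 : Prop :=
  forall (a b c d e q : D) (al be mu nu : nat),
  let k := sector c in
  (al < Nfus c (bact k a) e)%N -> (be < Nfus e (bact k b) d)%N ->
  (mu < Nfus b c q)%N -> (nu < Nfus a q d)%N ->
  \sum_(la < Nfus a c e) \sum_(ga < Nfus c (bact k b) q)
     Rs a c e al la * Fs a c (bact k b) d e la be q ga nu * Rs b c q ga mu
  = \sum_(f : D) \sum_(de < Nfus (bact k a) (bact k b) (bact k f))
    \sum_(si < Nfus c (bact k f) d) \sum_(ep < Nfus a b f)
    \sum_(ps < Nfus f c d)
     Fs c (bact k a) (bact k b) d e al be (bact k f) de si *
     Us k a b f de ep * Rs f c d si ps * Fs a b c d f ep ps q mu nu.

Definition heptagon2 : Prop :=
  forall (a b c d e q : D) (al be mu nu : nat),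
  let g := sector a in let h := sector b in
  (al < Nfus c a e)%N -> (be < Nfus e b d)%N ->
  (mu < Nfus b (bact (g * h)%g c) q)%N -> (nu < Nfus a q d)%N ->
  \sum_(la < Nfus a (bact g c) e) \sum_(ga < Nfus (bact g c) b q)
     Rinv c a e al la * Fs a (bact g c) b d e la be q ga nu *
     Rinv (bact g c) b q ga mu
  = \sum_(f : D) \sum_(de < Nfus a b f) \sum_(si < Nfus c f d)
    \sum_(ps < Nfus f (bact (g * h)%g c) d)
     Fs c a b d e al be f de si * eta c g h * Rinv c f d si ps *
     Fs a b (bact (g * h)%g c) d f de ps q mu nu.

Definition eta_cocycle : Prop :=
  forall x g h k,
  eta x g h * eta x (g * h)%g k = eta (bact g x) h k * eta x g (h * k)%g.

Definition U_eta_consistency : Prop :=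
  forall k l a b c (al nu : nat),
  (al < Nfus (bact (k * l)%g a) (bact (k * l)%g b) (bact (k * l)%g c))%N ->
  (nu < Nfus a b c)%N ->
  eta a k l * eta b k l *
  (\sum_(be < Nfus (bact k a) (bact k b) (bact k c))
     Us l (bact k a) (bact k b) (bact k c) al be * Us k a b c be nu)
  = Us (k * l)%g a b c al nu * eta c k l.

(* The action of k preserves the associator. *)
Definition F_invariance : Prop :=
  forall k a b c d e f (al be mu nu : nat),
  (al < Nfus (bact k a) (bact k b) (bact k e))%N ->
  (be < Nfus (bact k e) (bact k c) (bact k d))%N ->
  (mu < Nfus b c f)%N -> (nu < Nfus a f d)%N ->
  \sum_(al' < Nfus a b e) \sum_(be' < Nfus e c d)
     Us k a b e al al' * Us k e c d be be' * Fs a b c d e al' be' f mu nu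
  = \sum_(mu' < Nfus (bact k b) (bact k c) (bact k f))
    \sum_(nu' < Nfus (bact k a) (bact k f) (bact k d))
     Fs (bact k a) (bact k b) (bact k c) (bact k d)
        (bact k e) al be (bact k f) mu' nu' *
     Us k b c f mu' mu * Us k a f d nu' nu.

(* The action of k preserves the G-crossed braiding; the eta factors compare
   the two decompositions h k = k (k^-1 h k) of the action on a, where
   h = sector b. *)
Definition R_invariance : Prop :=
  forall k a b c (mu nu : nat),
  let h := sector b in
  (mu < Nfus (bact k b) (bact k (bact h a)) (bact k c))%N ->
  (nu < Nfus a b c)%N ->
  eta a h k *
  (\sum_(la < Nfus b (bact h a) c)
     Us k b (bact h a) c mu la * Rs a b c la nu)
  = eta a k (k^-1 * h * k)%g *
  (\sum_(la < Nfus (bact k a) (bact k b) (bact k c))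
     Rs (bact k a) (bact k b) (bact k c) mu la * Us k a b c la nu).

Definition ribbon_property : Prop :=
  forall a b c (mu nu : nat),
  let g := sector a in let h := sector b in
  (mu < Nfus (bact h a) (bact (h^-1 * g * h)%g b) c)%N -> (nu < Nfus a b c)%N ->
  \sum_(la < Nfus b (bact h a) c)
     Rs b (bact h a) c mu la * Rs a b c la nu
  = theta c / (theta a * theta b) *
    (Us (g * h)%g a b c mu nu / (eta a g h * eta b h (h^-1 * g * h)%g)).

(* Modularity of the trivial sector: its topological S-matrix
   S_{ab} = (1/D) sum_c N_{a bbar}^c (theta_c / (theta_a theta_b)) d_c
   is invertible. *)
Definition anyon : finType := {a : D | sector a == 1%g}.

Definition total_qdim : R := Num.sqrt (\sum_(a : anyon) qdim (val a) ^+ 2).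

Definition Sentry a b : R[i] :=
  (total_qdim^-1)%:C%C *
  \sum_(c : D) (Nfus a (dobj b) c)%:R * (theta c / (theta a * theta b)) *
               (qdim c)%:C%C.

Definition Smatrix : 'M[R[i]]_#|{: anyon}| :=
  \matrix_(i, j) Sentry (val (enum_val i)) (val (enum_val j)).

Definition modular : Prop := Smatrix \in unitmx.

End Theory.

(* A G-crossed braided extension of the unitary modular tensor category formed
   by its trivial sector. *)
Record gcrossedBTC (R : realType) (G : finGroupType) := GcrossedBTC {
  gdata :> gcross_data R G;
  _ : fusion_axioms gdata;
  _ : qdim_axioms gdata;
  _ : grading_axioms gdata;
  _ : unitarity_axioms gdata;
  _ : normalization_axioms gdata;
  _ : pentagon gdata;
  _ : heptagon1 gdata;
  _ : heptagon2 gdata;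
  _ : eta_cocycle gdata;
  _ : U_eta_consistency gdata;
  _ : F_invariance gdata;
  _ : R_invariance gdata;
  _ : ribbon_property gdata;
  _ : modular gdata
}.

Section Defects.
Variables (R : realType) (G : finGroupType) (C : gcrossedBTC R G).
Implicit Types (a b : C) (k : G).

Definition abelian_defect k a : Prop := sector a = k /\ qdim a = 1.

Definition abelian_anyon a : Prop := abelian_defect 1%g a.

Definition no_permutation : Prop :=
  forall k a, sector a = 1%g -> gact k a = a.

(* The fusion product a x b; meaningful when a or b is Abelian, in which case
   there is exactly one fusion channel. *)
Definition fuse a b : C := odflt (vac C) [pick c | (0 < Nfus a b c)%N].

Definition fuse_pow a (n : nat) : C := iter n (fuse a) (vac C).

(* R^{a,b} and M_{a,b} = R^{a,b} R^{b,a} for Abelian a, b. *)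
Definition Rab a b : R[i] := Rs a b (fuse a b) 0 0.

Definition Mab a b : R[i] := Rab a b * Rab b a.

(* p * q is the x in [0,1[ with e^{2 pi i x} = M_{p,q}. *)
Definition pstar a b : R :=
  xget 0 [set x : R | 0 <= x < 1 /\ cis x = Mab a b].

(* I_n(a), for a an Abelian k-defect with k^n = 1. *)
Definition Iinv (n : nat) a : R[i] :=
  theta a ^+ n * \prod_(j < n) eta a (sector a) (sector a ^+ j)%g.

(* A choice of Abelian defects 0_k, with 0_1 trivial, and the cocycle w such
   that 0_k x 0_l = w(k,l) x 0_{kl}. *)
Definition defect_section (s : G -> C) : Prop :=
  (forall k, abelian_defect k (s k)) /\ s 1%g = vac C.

Definition fractionalization_cocycle (s : G -> C) (w : G -> G -> C) : Prop :=
  forall k l, abelian_anyon (w k l) /\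
              fuse (s k) (s l) = fuse (w k l) (s (k * l)%g).

(* 2-cocycles of H with (trivial) coefficients in the group of Abelian
   anyons. *)
Definition cocycle2 (H : finGroupType) (w : H -> H -> C) : Prop :=
  (forall x y, abelian_anyon (w x y)) /\
  (forall x y z, fuse (w x y) (w (x * y)%g z)
                 = fuse (w y z) (w x (y * z)%g)).

End Defects.

(* The symmetry fractionalization class is a product of pullbacks of classes
   along the two projections: w = w1 w2 d(eps).  The class of w does not depend
   on the chosen defects s. *)
Definition no_mixed_fractionalization (R : realType) (H K : finGroupType)
    (C : gcrossedBTC R (H * K)%type) : Prop :=
  exists (s : H * K -> C) (w : H * K -> H * K -> C),
    [/\ defect_section s, fractionalization_cocycle s w &
    exists (w1 : H -> H -> C) (w2 : K -> K -> C) (eps : H * K -> C),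
      [/\ cocycle2 w1, cocycle2 w2, forall k, abelian_anyon (eps k) &
          forall k l : H * K,
            fuse (w k l) (eps (k * l)%g)
            = fuse (fuse (w1 k.1 l.1) (w2 k.2 l.2))
                    (fuse (eps k) (eps l))]].

(* Main.v *)
(* Abelian objects form a group B under fusion, in which Abelian anyons are
   central.  A 2-cocycle on a cyclic group with central values is symmetric, so
   without mixed fractionalization B is commutative and G fixes every Abelian
   object.  The consistency equations restricted to B become scalar identities,
   with F a 3-cocycle.  Write i_c F(a,b) = F(c,a,b) F(a,b,c) / F(a,c,b)
   for the slant product.

   The claim about T amounts to T^l = M_{p,q}.  Let a = 0_g, b = 0_h, N = mn.
   - The ribbon property and the U-eta relation express I_N(ab) through a and b,
     and the factors U_{gh}(a,b) cancel.
   - The second heptagon gives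
     R(c,ab) = R(c,a) R(c,b) eta_c(g,h) i_c F(a,b), which for c = a shows that
     eta_a(g,h) = eta_a(h,g).  Hence the product of the eta_a(gh,(gh)^j) splits,
     and I_N(ab) / (I_N(a) I_N(b)) is
     M_{a,b}^N prod_j eta_a(h,h^j) prod_j eta_b(g,g^j).
   - Expanding R(a^n,b^m) R(b^m,a^n) by the heptagons yields the same value, up
     to slant products of F, whose total contribution is 1 by the pentagons. *)
From HB Require Import structures.
Require Import Defs.
From mathcomp Require Import all_boot all_order all_algebra all_fingroup.
From mathcomp Require Import all_classical all_reals all_analysis.
From mathcomp Require Import complex.
From mathcomp Require Import ring lra.

Set Implicit Arguments.
Unset Strict Implicit.
Unset Printing Implicit Defensive.

Import Order.TTheory GRing.Theory Num.Theory.
Local Open Scope ring_scope.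

(** * Symmetry of 2-cocycles on cyclic groups *)

(* [op] need only be left cancellative on the values of [w], so that this applies
   both to Abelian objects under fusion and to phases. *)
Lemma cocycle_comm_mul (T : Type) (op : T -> T -> T) (H : finGroupType)
    (w : H -> H -> T)
    (wI : forall x y x1 y1 x2 y2,
       op (w x y) (w x1 y1) = op (w x y) (w x2 y2) -> w x1 y1 = w x2 y2)
    (wC : forall x y z, op (w x y) (w (x * y)%g z) = op (w y z) (w x (y * z)%g))
    (x y z : H) :
  commute x z -> commute y z -> w x z = w z x -> w y z = w z y ->
  w (x * y)%g z = w z (x * y)%g.
Proof.
move=> cxz cyz xz yz; apply: (wI x y).
by rewrite wC yz cyz -wC xz cxz wC.
Qed.

Lemma cocycle_comm_exp (T : Type) (op : T -> T -> T) (H : finGroupType)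
    (w : H -> H -> T)
    (wI : forall x y x1 y1 x2 y2,
       op (w x y) (w x1 y1) = op (w x y) (w x2 y2) -> w x1 y1 = w x2 y2)
    (wC : forall x y z, op (w x y) (w (x * y)%g z) = op (w y z) (w x (y * z)%g))
    (x z : H) (n : nat) :
  commute x z -> w 1%g z = w z 1%g -> w x z = w z x ->
  w (x ^+ n)%g z = w z (x ^+ n)%g.
Proof.
move=> cxz w1 xz; elim: n => [|n IHn]; first by rewrite expg0.
rewrite expgS; apply: (cocycle_comm_mul wI wC) => //.
exact/commute_sym/commuteX/commute_sym.
Qed.

(** Normalization of [w] is not assumed: the cocycle identity at [(1, 1, z)] and at [(z, 1, 1)]
    makes both values equal to [w 1 1]. *)
Lemma cocycle1 (T : Type) (op : T -> T -> T) (H : finGroupType)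
    (w : H -> H -> T)
    (wI : forall x y x1 y1 x2 y2,
       op (w x y) (w x1 y1) = op (w x y) (w x2 y2) -> w x1 y1 = w x2 y2)
    (wC : forall x y z, op (w x y) (w (x * y)%g z) = op (w y z) (w x (y * z)%g))
    (z : H) :
   (forall x y u v, op (w x y) (w u v) = op (w u v) (w x y)) ->
   w 1%g z = w z 1%g.
Proof.
move=> opC.
have h1 : w 1%g z = w 1%g 1%g.
  apply: (wI 1%g z); have := wC 1%g 1%g z.
  by rewrite !mul1g => <-; rewrite opC.
have h2 : w z 1%g = w 1%g 1%g.
  by apply: (wI z 1%g); have := wC z 1%g 1%g; rewrite !mulg1 => ->; rewrite opC.
by rewrite h1 h2.
Qed.

(** Symmetry is trivial at [(h, h)] and spreads to powers of [h] in one argument, then in the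
    other. *)
Lemma cyclic_cocycle_sym (T : Type) (op : T -> T -> T) (H : finGroupType)
    (w : H -> H -> T)
    (wI : forall x y x1 y1 x2 y2,
       op (w x y) (w x1 y1) = op (w x y) (w x2 y2) -> w x1 y1 = w x2 y2)
    (wC : forall x y z, op (w x y) (w (x * y)%g z) = op (w y z) (w x (y * z)%g))
    (opC : forall x y u v, op (w x y) (w u v) = op (w u v) (w x y))
    (h : H) (hgen : <[h]>%g = [set: H]) (x y : H) :
  w x y = w y x.
Proof.
have /cycleP[i ->] : x \in <[h]>%g by rewrite hgen inE.
have /cycleP[j ->] : y \in <[h]>%g by rewrite hgen inE.
have w1 z := cocycle1 wI wC z opC.
apply: (cocycle_comm_exp wI wC) => //; first exact: commuteX.
by apply/esym/(cocycle_comm_exp wI wC).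
Qed.

Lemma prod_periodic (K : comNzRingType) (m n : nat) (f : nat -> K) :
  (forall j, f (m + j)%N = f j) ->
  \prod_(j < m * n) f j = (\prod_(j < m) f j) ^+ n.
Proof.
move=> fm; elim: n => [|n IHn]; first by rewrite muln0 big_ord0.
rewrite mulnS big_split_ord /= exprS -IHn; congr (_ * _).
by apply: eq_bigr => i _; rewrite fm.
Qed.

(** * Scalar consistency equations on a commutative group of Abelian objects *)

Section PointedTheory.
Variables (K : fieldType) (B G : finGroupType) (sec : B -> G).
Variables (F : B -> B -> B -> K) (R : B -> B -> K).
Variables (U : G -> B -> B -> K) (eta : B -> G -> G -> K).
Implicit Types (a b c d x y : B) (u v : G).

Hypothesis BC : forall a b, (a * b = b * a)%g.
Hypothesis secM : forall a b, sec (a * b)%g = (sec a * sec b)%g.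
Hypothesis F_neq0 : forall a b c, F a b c != 0.
Hypothesis R_neq0 : forall a b, R a b != 0.
Hypothesis U_neq0 : forall u a b, U u a b != 0.
Hypothesis eta_neq0 : forall a u v, eta a u v != 0.
Hypothesis pent : forall a b c d,
  F (a * b)%g c d * F a b (c * d)%g = F a b c * F a (b * c)%g d * F b c d.
Hypothesis F1l : forall a b, F 1%g a b = 1.
Hypothesis F1m : forall a b, F a 1%g b = 1.
Hypothesis F1r : forall a b, F a b 1%g = 1.
Hypothesis R1l : forall a, R 1%g a = 1.
Hypothesis R1r : forall a, R a 1%g = 1.
Hypothesis U1 : forall a b, U 1%g a b = 1.
Hypothesis eta1l : forall a u, eta a 1%g u = 1.
Hypothesis eta1r : forall a u, eta a u 1%g = 1.
Hypothesis hept1 : forall a b c,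
  R a c * F a c b * R b c = F c a b * U (sec c) a b * R (a * b)%g c * F a b c.
Hypothesis hept2 : forall a b c,
  (R c a)^-1 * F a c b * (R c b)^-1
  = F c a b * eta c (sec a) (sec b) * (R c (a * b)%g)^-1 * F a b c.
Hypothesis etaC : forall x u v t,
  eta x u v * eta x (u * v)%g t = eta x v t * eta x u (v * t)%g.
Hypothesis Ueta : forall u v a b,
  eta a u v * eta b u v * (U v a b * U u a b)
  = U (u * v)%g a b * eta (a * b)%g u v.
Hypothesis ribbon : forall a b,
  R b a * R a b = R (a * b)%g (a * b)%g / (R a a * R b b) *
    (U (sec a * sec b)%g a b /
     (eta a (sec a) (sec b) * eta b (sec b) ((sec b)^-1 * sec a * sec b)%g)).

Definition slant c a b : K := F c a b * F a b c / F a c b.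

(** The invariant [Iinv] in scalar form, with the twist of an Abelian object written as [R x x]. *)
Definition inv_theta (N : nat) x : K :=
  R x x ^+ N * \prod_(j < N) eta x (sec x) (sec x ^+ j)%g.

Let sec1 : sec 1%g = 1%g.
Proof. by apply: (mulgI (sec 1%g)); rewrite -secM !mulg1. Qed.

Let secX a n : sec (a ^+ n)%g = (sec a ^+ n)%g.
Proof. by elim: n => [|n IHn]; rewrite ?expg0 // !expgS secM IHn. Qed.

Let secC a b : commute (sec a) (sec b).
Proof. by rewrite /commute -!secM BC. Qed.

Lemma slant_neq0 c a b : slant c a b != 0.
Proof. by rewrite /slant !mulf_neq0 ?invr_neq0 ?F_neq0. Qed.

Lemma slant1 a b : slant 1%g a b = 1.
Proof. by rewrite /slant F1l F1r F1m divr1 mulr1. Qed.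

Lemma braid_mulr c a b :
  R c (a * b)%g = R c a * R c b * eta c (sec a) (sec b) * slant c a b.
Proof.
have e := hept2 a b c.
have -> : R c (a * b)%g =
   (F c a b * eta c (sec a) (sec b) * F a b c) /
   ((R c a)^-1 * F a c b * (R c b)^-1).
  by rewrite e; field; rewrite ?F_neq0 ?R_neq0 ?eta_neq0.
rewrite /slant; field.
all: by rewrite ?F_neq0 ?R_neq0 ?eta_neq0.
Qed.

(** The first heptagon solved for [R (a * b) c]; in the trivial sector its [U] factor is 1. This
    case is enough for the anyons [a ^+ m] and [b ^+ n] in [monodromy_exp]. *)
Lemma braid_mull a b c : sec c = 1%g ->
  R (a * b)%g c = R a c * R b c / slant c a b.
Proof.
move=> c1; have e := hept1 a b c; rewrite c1 U1 in e.
have -> : R (a * b)%g c = (R a c * F a c b * R b c) / (F c a b * F a b c).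
  by rewrite e; field; rewrite ?F_neq0 ?R_neq0.
by rewrite /slant; field; rewrite ?F_neq0 ?R_neq0.
Qed.

Lemma braid_expr c b n :
  R c (b ^+ n)%g = R c b ^+ n * \prod_(j < n) eta c (sec b) (sec b ^+ j)%g
                   * \prod_(j < n) slant c b (b ^+ j)%g.
Proof.
elim: n => [|n IHn]; first by rewrite expg0 R1r !big_ord0 expr0 !mulr1.
rewrite expgS braid_mulr IHn secX !big_ord_recr /= exprS.
ring.
Qed.

Lemma braid_expl a c n : sec c = 1%g ->
  R (a ^+ n)%g c = R a c ^+ n / \prod_(j < n) slant c a (a ^+ j)%g.
Proof.
move=> c1; elim: n => [|n IHn].
  by rewrite expg0 R1l !big_ord0 expr0 invr1 mulr1.
rewrite expgS braid_mull // IHn !big_ord_recr /= exprS.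
have X0 : \prod_(j < n) slant c a (a ^+ j)%g != 0.
  by apply/prodf_neq0 => j _; apply: slant_neq0.
by field; rewrite X0 slant_neq0.
Qed.

(* The product of the pentagons over the six shuffles of (a, a') and (b, c),
   with the signs of the shuffles as exponents. *)
Lemma slant_shuffle a a' b c :
  slant a b c * slant a' b c * (slant b a a' * slant c a a')
  = slant (a * a')%g b c * slant (b * c)%g a a'.
Proof.
have n0 := F_neq0.
(* The first six factors occur on both sides of the product of pentagons; the last two groups are
   the denominators of the slant products on the left and on the right. *)
pose k := F (a * b)%g a' c * F a b (a' * c)%g * F (a * b)%g c a' *
          F b a (a' * c)%g * F a (a' * b)%g c * F b (a * c)%g a' *
          (F b a c * F b a' c * F a b a' * F a c a') *
          (F b (a * a')%g c * F a (b * c)%g a').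
have k0 : k != 0 by rewrite !mulf_neq0 ?F_neq0.
have e1 := pent a a' b c.
have e2 := pent a b a' c; rewrite (BC b a') in e2.
have e3 := pent a b c a'; rewrite (BC c a') in e3.
have e4 := pent b a a' c; rewrite (BC b a) in e4.
have e5 := pent b a c a'; rewrite (BC b a) (BC c a') in e5.
have e6 := pent b c a a'; rewrite (BC c a) in e6.
have e := congr2 *%R (congr2 *%R (congr2 *%R e1 e3) (congr2 *%R e4 e6))
                     (esym (congr2 *%R e2 e5)).
apply: (mulIf k0); rewrite /slant /k; apply: etrans (etrans (esym e) _).
  by field; rewrite ?n0.
by field; rewrite ?n0.
Qed.

(** Telescoping of [slant_shuffle] at [c = b ^+ j]: the factor [slant (b ^+ j.+1) a a'] produced at
    one step is consumed at the next. *)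
Lemma prod_slant_mul a a' b n :
  (\prod_(j < n) slant a b (b ^+ j)%g) * (\prod_(j < n) slant a' b (b ^+ j)%g) *
  slant b a a' ^+ n
  = (\prod_(j < n) slant (a * a')%g b (b ^+ j)%g) * slant (b ^+ n)%g a a'.
Proof.
elim: n => [|n IHn]; first by rewrite !big_ord0 expg0 slant1 expr0 !mulr1.
rewrite !big_ord_recr /= expgS exprS.
apply: (mulIf (slant_neq0 (b ^+ n)%g a a')).
have e := congr2 *%R IHn (slant_shuffle a a' b (b ^+ n)%g).
move: e; set X := \prod_(_ < _) _; set Y := \prod_(_ < _) _.
set Z := \prod_(_ < _) _ => e.
apply: etrans (etrans e _); ring.
Qed.

(** The left side collects the slant factors that [braid_expr] puts into the monodromy of [a ^+ m]
    and [b ^+ n], the right side those that [braid_expl] divides by; hence they cancel in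
    [monodromy_exp]. The induction on [m] multiplies by [prod_slant_mul] for [a] and [a ^+ m]. *)
Lemma prod_slant_exp a b m n :
  (\prod_(j < n) slant a b (b ^+ j)%g) ^+ m *
  (\prod_(i < m) slant b a (a ^+ i)%g) ^+ n
  = (\prod_(j < n) slant (a ^+ m)%g b (b ^+ j)%g) *
    (\prod_(i < m) slant (b ^+ n)%g a (a ^+ i)%g).
Proof.
elim: m => [|m IHm].
  rewrite !big_ord0 expg0 expr1n expr0 !mulr1.
  by under eq_bigr do rewrite slant1; rewrite big1_eq.
rewrite !(big_ord_recr m) /= expgS exprS exprMn.
have e := prod_slant_mul a (a ^+ m)%g b n.
have z0 : \prod_(j < n) slant (a ^+ m)%g b (b ^+ j)%g != 0.
  by apply/prodf_neq0 => j _; apply: slant_neq0.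
apply: (mulIf z0); move: (congr2 *%R e IHm).
set X := \prod_(_ < _) _; set Y := \prod_(_ < _) _.
set Z := \prod_(_ < _) _; set T := \prod_(_ < _) _; set V := \prod_(_ < _) _.
move=> e'; apply: etrans (etrans e' _); ring.
Qed.

(* In the central extension of [G] defined by [eta x] the lifts of [u] and [v]
   commute, so that the power of their product splits. *)
Lemma eta_prod_mul x u v n : commute u v -> eta x u v = eta x v u ->
  eta x u v ^+ n * \prod_(j < n) eta x (u * v)%g ((u * v) ^+ j)%g
  = (\prod_(j < n) eta x u (u ^+ j)%g) * (\prod_(j < n) eta x v (v ^+ j)%g) *
    eta x (u ^+ n)%g (v ^+ n)%g.
Proof.
move=> cuv euv.
have etaI u1 u2 v1 v2 w1 w2 : eta x u1 u2 * eta x v1 v2 = eta x u1 u2 * eta x w1 w2 ->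
    eta x v1 v2 = eta x w1 w2 by apply: mulfI.
elim: n => [|n IHn]; first by rewrite !big_ord0 !expg0 eta1l expr0 !mulr1.
have eC := cocycle_comm_exp etaI (etaC x) n cuv (etrans (eta1l _ _) (esym (eta1r _ _))) euv.
have cn : commute (u ^+ n)%g v by apply/commute_sym/commuteX/commute_sym.
rewrite !big_ord_recr /= !expgS exprS expgMn //.
set a := (u ^+ n)%g in eC cn *; set b := (v ^+ n)%g.
(* The cocycle identity regroups [(u v)(a b)] as [(u a)(v b)]; [eC] moves [v] past [a]. *)
have e : eta x u v * eta x (u * v)%g (a * b)%g * eta x a b =
   eta x u a * eta x v b * eta x (u * a)%g (v * b)%g.
  have vab : (v * (a * b) = a * (v * b))%g by rewrite !mulgA cn.
  rewrite etaC vab mulrAC [eta x v _ * _]mulrC -etaC -eC -cn etaC -!mulrA.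
  by rewrite [RHS]mulrCA etaC.
apply: (mulIf (eta_neq0 x a b)); move: (congr2 *%R IHn e).
set X := \prod_(_ < _) _; set Y := \prod_(_ < _) _.
set Z := \prod_(_ < _) _.
move=> e'; apply: etrans (etrans e' _); ring.
Qed.

(* Compare [R a (a * b)] with [R a (b * a)]: the slant product of [F] by [a]
   takes the same value at (a, b) and (b, a). *)
Lemma eta_self_sym a b : eta a (sec a) (sec b) = eta a (sec b) (sec a).
Proof.
have := braid_mulr a a b; rewrite BC braid_mulr /slant.
have nz := F_neq0; have nR := R_neq0 => e.
have z : R a a * R a b * F a b a != 0 by rewrite !mulf_neq0.
apply: (mulIf z); move: e.
have -> : F a a b * F a b a / F a a b = F a b a by field; rewrite nz.
have -> : F a b a * F b a a / F b a a = F a b a by field; rewrite nz.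
by move=> e; apply: etrans (etrans (esym e) _); ring.
Qed.

(** [Ueta] at [(u, u ^+ j)] telescopes in [j]. When [u ^+ n = 1] the only [U] factor left is
    [U u a b ^+ n], which matches the [n]-th power of [twist_mul]. *)
Lemma prod_Ueta a b u n :
  (\prod_(j < n) eta a u (u ^+ j)%g) * (\prod_(j < n) eta b u (u ^+ j)%g) *
  U u a b ^+ n
  = U (u ^+ n)%g a b * \prod_(j < n) eta (a * b)%g u (u ^+ j)%g.
Proof.
elim: n => [|n IHn]; first by rewrite !big_ord0 expg0 U1 expr0 !mulr1.
rewrite !big_ord_recr /= expgS exprS.
apply: (mulIf (U_neq0 (u ^+ n)%g a b)).
have e := congr2 *%R IHn (Ueta u (u ^+ n)%g a b); move: e.
set X := \prod_(_ < _) _; set Y := \prod_(_ < _) _.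
set Z := \prod_(_ < _) _ => e.
apply: etrans (etrans e _); ring.
Qed.

(** The ribbon property without denominators: sectors commute, so the conjugated sector is [sec a],
    and [eta_self_sym] swaps the two group arguments of [eta b]. *)
Lemma twist_mul a b :
  R (a * b)%g (a * b)%g * U (sec a * sec b)%g a b
  = R a a * R b b * (R a b * R b a) *
    (eta a (sec a) (sec b) * eta b (sec a) (sec b)).
Proof.
have := ribbon a b.
rewrite -mulgA (secC a b) mulKg -(eta_self_sym b a) -(secC a b) [R b a * _]mulrC => ->.
by field; rewrite ?R_neq0 ?eta_neq0 ?U_neq0.
Qed.

Lemma monodromy_exp a b m n : (sec a ^+ m = 1)%g -> (sec b ^+ n = 1)%g ->
  R (a ^+ m)%g (b ^+ n)%g * R (b ^+ n)%g (a ^+ m)%g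
  = (R a b * R b a) ^+ (m * n) *
    ((\prod_(j < n) eta a (sec b) (sec b ^+ j)%g) ^+ m *
     (\prod_(j < m) eta b (sec a) (sec a ^+ j)%g) ^+ n).
Proof.
(* Both powers lie in the trivial sector, so [braid_expl] applies to either order of the two. *)
move=> am bn; rewrite !braid_expl ?secX // !braid_expr.
have e := prod_slant_exp a b m n.
have n0 c d k : \prod_(j < k) slant c d (d ^+ j)%g != 0.
  by apply/prodf_neq0 => j _; apply: slant_neq0.
rewrite (mulnC m n) exprMn {1}(mulnC n m) !exprMn -!exprM.
apply: (mulIf (mulf_neq0 (n0 (a ^+ m)%g b n) (n0 (b ^+ n)%g a m))).
rewrite -[in RHS]e; move: (n0 (a ^+ m)%g b n) (n0 (b ^+ n)%g a m).
set X := \prod_(_ < _) slant (_ ^+ _)%g _ _.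
set Y := \prod_(_ < _) slant (_ ^+ _)%g _ _ => x0 y0.
rewrite (mulnC n m).
by field; rewrite x0 y0.
Qed.

Theorem inv_theta_mul a b m n : (sec a ^+ m = 1)%g -> (sec b ^+ n = 1)%g ->
  inv_theta (m * n) (a * b)%g
  = R (a ^+ m)%g (b ^+ n)%g * R (b ^+ n)%g (a ^+ m)%g *
    (inv_theta (m * n) a * inv_theta (m * n) b).
Proof.
move=> am bn; rewrite monodromy_exp // /inv_theta secM.
set N := (m * n)%N; set u := sec a in am *; set v := sec b in bn *.
have uN : (u ^+ N = 1)%g by rewrite expgM am expg1n.
have vN : (v ^+ N = 1)%g by rewrite /N mulnC expgM bn expg1n.
have cuv : commute u v by apply: secC.
have eU := prod_Ueta a b (u * v)%g N.
rewrite expgMn // uN vN mulg1 U1 mul1r in eU.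
have eA := eta_prod_mul N cuv (eta_self_sym a b).
have eB := eta_prod_mul N cuv (esym (eta_self_sym b a)).
rewrite uN vN eta1l mulr1 in eA; rewrite uN vN eta1l mulr1 in eB.
have pA : \prod_(j < N) eta a v (v ^+ j)%g =
          (\prod_(j < n) eta a v (v ^+ j)%g) ^+ m.
  rewrite /N mulnC; apply: (prod_periodic _ (f := fun j => eta a v (v ^+ j)%g)).
  by move=> j; rewrite expgD bn mul1g.
have pB : \prod_(j < N) eta b u (u ^+ j)%g =
          (\prod_(j < m) eta b u (u ^+ j)%g) ^+ n.
  apply: (prod_periodic _ (f := fun j => eta b u (u ^+ j)%g)).
  by move=> j; rewrite expgD am mul1g.
rewrite -pA -pB -eU.
(* In the [N]-th power of the twist formula, [eA] and [eB] absorb the factors [eta a u v] and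
   [eta b u v], while [eU] has accounted for the powers of [U]. *)
have eT := congr1 (fun z => z ^+ N) (twist_mul a b).
rewrite /= !exprMn in eT.
have := congr2 *%R eT (congr2 *%R eA eB).
have z : (eta a u v * eta b u v) ^+ N != 0 by rewrite expf_neq0 ?mulf_neq0.
move=> e; apply: (mulIf z); rewrite !exprMn.
apply: etrans (etrans e _); rewrite -/u -/v; ring.
Qed.
End PointedTheory.

(** * The group of Abelian objects under fusion *)

Section AbelianObjects.
Variables (R : realType) (G : finGroupType) (C : gcrossedBTC R G).
Implicit Types a b c d : C.

Lemma fusionP : fusion_axioms C. Proof. by case: C. Qed.
Lemma qdimP : qdim_axioms C. Proof. by case: C. Qed.
Lemma gradingP : grading_axioms C. Proof. by case: C. Qed.
Lemma unitarityP : unitarity_axioms C. Proof. by case: C. Qed.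
Lemma normalizationP : normalization_axioms C. Proof. by case: C. Qed.
Lemma pentagonP : pentagon C. Proof. by case: C. Qed.
Lemma heptagon1P : heptagon1 C. Proof. by case: C. Qed.
Lemma heptagon2P : heptagon2 C. Proof. by case: C. Qed.
Lemma eta_cocycleP : eta_cocycle C. Proof. by case: C. Qed.
Lemma U_etaP : U_eta_consistency C. Proof. by case: C. Qed.
Lemma ribbonP : ribbon_property C. Proof. by case: C. Qed.

(** The product of [a] with its dual contains the vacuum, so the square of its dimension is at least
    1. *)
Lemma qdim_ge1 a : 1 <= qdim a.
Proof.
have [qpos [q1 [qd [qM _]]]] := qdimP; have [_ [_ [Nd _]]] := fusionP.
have : 1 <= qdim a * qdim (dobj a).
  rewrite qM (bigD1 (vac C)) //= Nd eqxx q1 mulr1 lerDl.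
  by apply: sumr_ge0 => c _; rewrite mulr_ge0 ?ler0n ?ltW.
by rewrite qd -expr2 expr_ge1 // ltW.
Qed.

(** The terms [Nfus a b c * qdim c] add up to 1, and each nonzero one is at least 1 by [qdim_ge1];
    so there is a single channel, with multiplicity and dimension 1. *)
Lemma fuse_channel a b : qdim a = 1 -> qdim b = 1 ->
  exists2 c, qdim c = 1 & forall d, Nfus a b d = (d == c).
Proof.
move=> qa qb; have [qpos [q1 [qd [qM _]]]] := qdimP.
have := qM a b; rewrite qa qb mulr1.
have [c Nc|N0] := pickP (fun c => 0 < Nfus a b c)%N; last first.
  rewrite big1 => [/esym/eqP|c _]; first by rewrite eq_sym oner_eq0.
  by have := N0 c; rewrite lt0n => /negbFE/eqP ->; rewrite mul0r.
have tge0 d : 0 <= (Nfus a b d)%:R * qdim d by rewrite mulr_ge0 ?ler0n ?ltW.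
rewrite (bigD1 c) //=; set S := \sum_(_ | _) _ => e.
have S0 : 0 <= S by apply: sumr_ge0.
have N1 : (1 : R) <= (Nfus a b c)%:R by rewrite ler1n.
have qN : qdim c <= (Nfus a b c)%:R * qdim c by rewrite ler_peMl // ltW.
have NN : (Nfus a b c)%:R <= (Nfus a b c)%:R * qdim c :> R.
  by rewrite ler_peMr ?ler0n // qdim_ge1.
have t1 : (Nfus a b c)%:R * qdim c <= 1 by rewrite [leRHS]e lerDl.
have qc : qdim c = 1 by apply/le_anti; rewrite qdim_ge1 (le_trans qN).
have Nc1 : Nfus a b c = 1%N.
  by apply/eqP; rewrite eqn_leq Nc -(ler_nat R) (le_trans NN).
exists c => // d; case: eqP => [-> //|/eqP dc].
have SE : S = 0 by apply: (addrI 1); rewrite addr0 [RHS]e Nc1 qc mulr1.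
have := psumr_eq0P (fun d _ => tge0 d) SE => /(_ d dc)/eqP.
by rewrite mulf_eq0 (gt_eqF (qpos d)) orbF pnatr_eq0 => /eqP.
Qed.

Lemma fuse_unique a b c : (forall d, Nfus a b d = (d == c)) -> fuse a b = c.
Proof.
move=> Nc; rewrite /fuse; case: pickP => [d|/(_ c)]; last by rewrite Nc eqxx.
by rewrite Nc lt0b => /eqP.
Qed.

Lemma fuse_abelian a b : qdim a = 1 -> qdim b = 1 ->
  qdim (fuse a b) = 1 /\ forall d, Nfus a b d = (d == fuse a b).
Proof.
by move=> qa qb; have [c qc Nc] := fuse_channel qa qb; rewrite (fuse_unique Nc).
Qed.

(** Anyons and defects of all sectors together; the boolean condition makes this a finite subtype of
    the labels, ready for a finite group structure. *)
Definition abobj : Type := {a : C | qdim a == 1}.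
HB.instance Definition _ := [isSub of abobj for @sval _ _].
HB.instance Definition _ := [Finite of abobj by <:].
Implicit Types x y z : abobj.

Lemma qdim_val x : qdim (val x) = 1. Proof. exact/eqP/(valP x). Qed.

Lemma abmul_subproof x y : qdim (fuse (val x) (val y)) == 1.
Proof. by have [-> _] := fuse_abelian (qdim_val x) (qdim_val y). Qed.
Definition abmul x y : abobj := Sub (fuse (val x) (val y)) (abmul_subproof x y).

Lemma abone_subproof : qdim (vac C) == 1.
Proof. by apply/eqP; case: qdimP => _ []. Qed.
Definition abone : abobj := Sub (vac C) abone_subproof.

Lemma abinv_subproof x : qdim (dobj (val x)) == 1.
Proof. by have [_ [_ [-> _]]] := qdimP; rewrite qdim_val. Qed.
Definition abinv x : abobj := Sub (dobj (val x)) (abinv_subproof x).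

Lemma Nfus_abmul x y d : Nfus (val x) (val y) d = (d == val (abmul x y)).
Proof. by have [_ ->] := fuse_abelian (qdim_val x) (qdim_val y). Qed.

Lemma abmulA : associative abmul.
Proof.
move=> x y z; apply/val_inj.
have [_ [_ [_ [_ [_ NA]]]]] := fusionP.
have := NA (val x) (val y) (val z) (val (abmul x (abmul y z))).
rewrite (bigD1 (val (abmul x y))) //= big1 ?addn0 => [|e /negbTE ne]; last first.
  by rewrite Nfus_abmul ne.
rewrite (bigD1 (val (abmul y z))) //= big1 ?addn0 => [|e /negbTE ne]; last first.
  by rewrite Nfus_abmul ne.
rewrite -!/(val (abmul _ _)).
rewrite (Nfus_abmul x y) (Nfus_abmul y z) (Nfus_abmul (abmul x y)).
by rewrite (Nfus_abmul x (abmul y z)) !eqxx !mul1n; case: eqP.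
Qed.

Lemma abmul1 : left_id abone abmul.
Proof.
move=> x; apply/val_inj/fuse_unique => d; have [_ [-> _]] := fusionP.
by rewrite eq_sym.
Qed.

Lemma abmulV : left_inverse abone abinv abmul.
Proof.
move=> x; apply/val_inj => /=; have := Nfus_abmul (abinv x) x (vac C).
have [_ [_ [-> [-> _]]]] := fusionP.
by rewrite eqxx; case: eqP.
Qed.

HB.instance Definition _ := Finite_isGroup.Build abobj abmulA abmul1 abmulV.

Lemma val_mulg x y : val (x * y)%g = fuse (val x) (val y). Proof. by []. Qed.
Lemma val_oneg : val (1%g : abobj) = vac C. Proof. by []. Qed.

Lemma val_expg x n : val (x ^+ n)%g = fuse_pow (val x) n.
Proof. by elim: n => // n IHn; rewrite expgS val_mulg IHn. Qed.

Lemma Nfus_val x y d : Nfus (val x) (val y) d = (d == val (x * y)%g).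
Proof. exact: Nfus_abmul. Qed.

Lemma Nfus1 x y z : z = (x * y)%g -> Nfus (val x) (val y) (val z) = 1%N.
Proof. by move=> ->; rewrite Nfus_val eqxx. Qed.

Lemma sector_mul x y :
  sector (val (x * y)%g) = (sector (val x) * sector (val y))%g.
Proof.
have [_ [Ns _]] := gradingP.
by apply: Ns; rewrite Nfus1.
Qed.


(** Moving [x] past [y] acts on [x] by a group element, and an anyon is fixed by the action. *)
Lemma anyon_central x y : sector (val x) = 1%g -> no_permutation C -> (y * x = x * y)%g.
Proof.
move=> sx noperm; apply/val_inj; rewrite [RHS]val_mulg; apply/esym/fuse_unique => d.
have [_ [_ [_ [_ [_ [_ [_ NC]]]]]]] := gradingP.
by rewrite NC /bact noperm // Nfus_val.
Qed.

(* The abelian defect [y] braids past [x] at the cost of acting on [x]. *)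
Lemma bact_comm x y : (x * y = y * x)%g -> bact (sector (val y)) (val x) = val x.
Proof.
move=> xy; have [_ [_ [_ [_ [_ [_ [_ NC]]]]]]] := gradingP.
have e : Nfus (val y) (bact (sector (val y)) (val x)) (val (x * y)%g) = 1%N.
  by rewrite -NC Nfus1.
have [_ [_ [_ [_ [_ NA]]]]] := fusionP.
set z := bact _ _ in e *.
(* [z] is not yet known to be Abelian, so [val y] is cancelled through associativity of the fusion
   coefficients rather than in the group. *)
have := NA (val y^-1%g) (val y) z (val x).
rewrite (bigD1 (val (1%g : abobj))) // big1 ?addn0 => [|f /negbTE ne]; last first.
  by rewrite Nfus_val mulVg ne.
rewrite Nfus1 ?mulVg // mul1n val_oneg.
have [_ [-> _]] := fusionP.
rewrite (bigD1 (val (x * y)%g)) // e (@Nfus1 _ (x * y)%g x) ?xy ?mulKg //.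
by case: eqP.
Qed.

End AbelianObjects.

(** * Commutativity of Abelian objects and triviality of the action on them *)

Lemma cyclic_commute (H : finGroupType) (h : H) : <[h]>%g = [set: H] ->
  forall x y : H, commute x y.
Proof.
move=> gen x y.
have /cycleP[i ->] : x \in <[h]>%g by rewrite gen inE.
have /cycleP[j ->] : y \in <[h]>%g by rewrite gen inE.
exact/commuteX/commute_sym/commuteX.
Qed.

Section NoMixedFractionalization.
Variables (R : realType) (H K : finGroupType) (C : gcrossedBTC R (H * K)%type).
Variables (h : H) (k : K).
Hypothesis hgen : <[h]>%g = [set: H].
Hypothesis kgen : <[k]>%g = [set: K].
Hypothesis noperm : no_permutation C.
Hypothesis nomixed : no_mixed_fractionalization C.
Implicit Types x y : abobj C.

Lemma cocycle2_sym (L : finGroupType) (l : L) (w : L -> L -> C) :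
  <[l]>%g = [set: L] -> cocycle2 w -> forall u v, w u v = w v u.
Proof.
move=> lgen [wab wC] u v.
have wq u1 u2 : qdim (w u1 u2) == 1 by have [_ ->] := wab u1 u2.
pose w' u1 u2 : abobj C := Sub (w u1 u2) (wq u1 u2).
suff : w' u v = w' v u by move=> /(congr1 val).
apply: (@cyclic_cocycle_sym _ (fun x y => (x * y)%g) L w' _ _ _ l) => //.
- by move=> ? ? ? ? ? ?; apply: mulgI.
- by move=> u1 u2 u3; apply/val_inj/wC.
- by move=> u1 u2 u3 u4; apply: anyon_central => //; have [] := wab u3 u4.
Qed.

(** Every Abelian object is a central anyon times the chosen defect of its sector, so it suffices
    that [w] is symmetric. Both [w1] and [w2] are, on cyclic groups, and so is the coboundary of
    [eps], because the grading group is commutative. *)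
Lemma abobj_comm x y : (x * y = y * x)%g.
Proof.
have [s [w [[sab _] wfrac [w1 [w2 [eps [w1C w2C epsab wE]]]]]]] := nomixed.
have HKC (u v : (H * K)%type) : (u * v = v * u)%g.
  case: u v => u1 u2 [v1 v2].
  by congr pair; [apply: (cyclic_commute hgen) | apply: (cyclic_commute kgen)].
have sq u : qdim (s u) == 1 by have [_ ->] := sab u.
have epsq u : qdim (eps u) == 1 by have [_ ->] := epsab u.
have wq u v : qdim (w u v) == 1 by have [[_ ->]] := wfrac u v.
pose s' u : abobj C := Sub (s u) (sq u).
pose e' u : abobj C := Sub (eps u) (epsq u).
pose w' u v : abobj C := Sub (w u v) (wq u v).
have eC u v : (e' u * e' v = e' v * e' u)%g.
  by apply: anyon_central => //; have [] := epsab v.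
have wsym u v : w' u v = w' v u.
  apply: (mulIg (e' (u * v)%g)); apply/val_inj; rewrite [in RHS]HKC /= !wE.
  rewrite (cocycle2_sym hgen w1C) (cocycle2_sym kgen w2C).
  by have /(congr1 val)/= -> := eC u v.
have sC u v : (s' u * s' v = s' v * s' u)%g.
  have E u1 u2 : (s' u1 * s' u2 = w' u1 u2 * s' (u1 * u2))%g.
    by apply/val_inj => /=; have [_ ->] := wfrac u1 u2.
  by rewrite !E wsym HKC.
(* The anyon part of [z]: dividing by the chosen defect of the same sector leaves the trivial
   sector. *)
pose t (z : abobj C) : abobj C := (z * (s' (sector (val z)))^-1)%g.
have tC z z' : (z' * t z = t z * z')%g.
  apply: anyon_central => //; apply: (mulIg (sector (s (sector (val z))))).
  rewrite -[s _]/(val (s' (sector (val z)))) -sector_mul mulgKV mul1g.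
  by have [] := sab (sector (val z)).
have tE z : (z = t z * s' (sector (val z)))%g by rewrite mulgKV.
have E z z' u v : (t z * u * (t z' * v) = t z * t z' * (u * v))%g.
  by rewrite -mulgA (mulgA u (t z') v) (tC z' u) !mulgA.
rewrite [in LHS](tE x) [in LHS](tE y) [in RHS](tE x) [in RHS](tE y) !E.
by rewrite sC tC.
Qed.

(** Each sector [u] contains an Abelian defect; [x] commutes with it, hence is fixed by [u]. *)
Lemma bact_val u x : bact u (val x) = val x.
Proof.
have [s [_ [[sab _] _ _]]] := nomixed.
have sq : qdim (s u) == 1 by have [_ ->] := sab u.
pose y : abobj C := Sub (s u) sq.
have <- : sector (val y) = u by have [] := sab u.
by apply: bact_comm; apply: abobj_comm.
Qed.

End NoMixedFractionalization.

(** * Reduction of the skeletal data to scalars on Abelian objects *)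

Lemma sum_ord1 (V : nmodType) (n : nat) (n1 : n = 1%N) (E : 'I_n -> V) :
  \sum_(i < n) E i = E (cast_ord (esym n1) ord0).
Proof. by case: _ / (esym n1) E => E; rewrite big_ord1 cast_ord_id. Qed.

Lemma unitary_array_entry (R : realType) (m n : nat) (A : nat -> nat -> R[i]) :
  m = 1%N -> n = 1%N -> unitary_array m n A -> A 0 0 * (A 0 0)^* = 1.
Proof.
move=> -> -> [/(_ 0%N 0%N isT isT) + _]; by rewrite big_ord1.
Qed.

Lemma unit_conj (R : realType) (z : R[i]) : z * z^* = 1 ->
  [/\ z != 0, z^* = z^-1 & `|z| = 1].
Proof.
move=> zz; have z0 : z != 0.
  by apply: contra_eq_neq zz => ->; rewrite mul0r eq_sym oner_eq0.
split=> //; first by apply: (mulfI z0); rewrite zz mulfV.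
by apply/eqP; rewrite -(@pexpr_eq1 _ _ 2) // normCK zz.
Qed.

Section Symbols.
Variables (R : realType) (G : finGroupType) (C : gcrossedBTC R G).
Implicit Types (x y z : abobj C) (u v : G).

(** Away from the product channel the inner index set is empty. In that channel the multiplicity is
    1 only propositionally, hence the cast of the index 0. *)
Lemma sum_fuse x y (V : nmodType) (n : C -> nat)
    (nE : forall c, n c = (c == val (x * y)%g)) (E : forall c, 'I_(n c) -> V)
    (n1 : n (val (x * y)%g) = 1%N) :
  \sum_(c : C) \sum_(i < n c) E c i
  = E (val (x * y)%g) (cast_ord (esym n1) ord0).
Proof.
rewrite (bigD1 (val (x * y)%g)) //= (sum_ord1 n1) big1 ?addr0 // => c /negbTE nc.
by apply: big1 => i _; case: i => i ilt; exfalso; move: ilt; rewrite nE nc.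
Qed.

(** All multiplicities are 1, so the symbol is its entry at the unique admissible channels, with
    every basis index 0. *)
Definition Fab x y z : R[i] :=
  Fs (val x) (val y) (val z) (val (x * y * z)%g)
     (val (x * y)%g) 0 0 (val (y * z)%g) 0 0.
Definition Rabel x y : R[i] := Rs (val x) (val y) (val (x * y)%g) 0 0.
Definition Uab u x y : R[i] := Us u (val x) (val y) (val (x * y)%g) 0 0.
Definition etaab x : G -> G -> R[i] := eta (val x).
Definition secab x : G := sector (val x).

Lemma FabE x y z t e f : t = (x * y * z)%g -> e = (x * y)%g -> f = (y * z)%g ->
  Fs (val x) (val y) (val z) (val t) (val e) 0 0 (val f) 0 0 = Fab x y z.
Proof. by move=> -> -> ->. Qed.

Lemma RabelE x y t : t = (x * y)%g ->
  Rs (val x) (val y) (val t) 0 0 = Rabel x y.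
Proof. by move=> ->. Qed.

Lemma UabE u x y t : t = (x * y)%g ->
  Us u (val x) (val y) (val t) 0 0 = Uab u x y.
Proof. by move=> ->. Qed.

Lemma theta_val x : theta (val x) = Rabel x x.
Proof.
rewrite /theta (sum_fuse (Nfus_val x x)); first by rewrite Nfus1.
move=> n1 /=; rewrite -[fuse _ _]/(val (x * x)%g) !qdim_val divr1.
by have -> : (1 : R)%:C%C = 1 by []; rewrite mul1r.
Qed.

Lemma Fab_neq0 x y z : Fab x y z != 0.
Proof.
have [[FU _] _] := unitarityP C.
have := FU (val x) (val y) (val z) (val (x * y * z)%g) (val (x * y)%g) 0%N 0%N
           (val (x * y)%g) 0%N 0%N.
rewrite !Nfus1 // => /(_ isT isT isT isT).
rewrite (sum_fuse (Nfus_val y z)); first by rewrite Nfus1.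
move=> n1; rewrite sum_ord1; first by rewrite Nfus1 ?mulgA.
move=> n2 /=; rewrite !eqxx => e; apply: contra_eq_neq e => e0.
by rewrite [X in X * _]e0 mul0r eq_sym oner_eq0.
Qed.

Hypothesis xC : forall x y, (x * y = y * x)%g.
Hypothesis act_val : forall u x, bact u (val x) = val x.

Lemma Rabel_unit x y : Rabel x y * (Rabel x y)^* = 1.
Proof.
have [_ [RU _]] := unitarityP C.
apply: unitary_array_entry (RU (val x) (val y) (val (x * y)%g)).
  by rewrite act_val Nfus1.
by rewrite Nfus1.
Qed.

Lemma Uab_unit u x y : Uab u x y * (Uab u x y)^* = 1.
Proof.
have [_ [_ [UU _]]] := unitarityP C.
apply: unitary_array_entry (UU u (val x) (val y) (val (x * y)%g)).
  by rewrite !act_val Nfus1.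
by rewrite Nfus1.
Qed.

Lemma etaab_neq0 x u v : etaab x u v != 0.
Proof.
have [_ [_ [_ eU]]] := unitarityP C.
by rewrite -normr_eq0 eU oner_eq0.
Qed.

Lemma Fab_pentagon x y z t :
  Fab (x * y)%g z t * Fab x y (z * t)%g
  = Fab x y z * Fab x (y * z)%g t * Fab y z t.
Proof.
have := @pentagonP _ _ C (val x) (val y) (val z) (val t) (val (x * y * z * t)%g)
  (val (x * y)%g) (val (x * y * z)%g) (val (y * z * t)%g) (val (z * t)%g)
  0%N 0%N 0%N 0%N 0%N 0%N.
rewrite !Nfus1 ?mulgA // => /(_ isT isT isT isT isT isT).
rewrite big_ord1 (sum_fuse (Nfus_val y z)); first by rewrite Nfus1.
move=> n2; rewrite sum_ord1; first by rewrite Nfus1 ?mulgA.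
move=> n3; rewrite sum_ord1; first by rewrite Nfus1 ?mulgA.
by move=> n4 /=; rewrite -!val_mulg !FabE ?mulgA.
Qed.


(** The sum over [f] in the first heptagon involves [bact k f] with [f] an arbitrary label, where
    [act_val] does not apply; invariance of the fusion coefficients identifies its channel. *)
Lemma Nfus_act u x y c : Nfus (val x) (val y) (bact u c) = (c == val (x * y)%g).
Proof.
have [_ [_ [_ [_ [_ [_ [gN _]]]]]]] := gradingP C.
by rewrite -{1}(act_val u x) -{1}(act_val u y) gN Nfus_val.
Qed.

Lemma Fab_heptagon1 x y z :
  Rabel x z * Fab x z y * Rabel y z
  = Fab z x y * Uab (secab z) x y * Rabel (x * y)%g z * Fab x y z.
Proof.
have := @heptagon1P _ _ C (val x) (val y) (val z) (val (x * y * z)%g)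
  (val (x * z)%g) (val (y * z)%g) 0%N 0%N 0%N 0%N.
rewrite /= -!val_mulg !act_val.
have e1 : (x * z = z * x)%g by [].
have e2 : (x * y * z = x * z * y)%g by rewrite -mulgA (xC y) mulgA.
have e3 : (x * y * z = z * x * y)%g by rewrite -xC mulgA.
rewrite (Nfus1 e1) (Nfus1 e2) (Nfus1 (xC y z)) (Nfus1 (esym (mulgA x y z))).
rewrite (@Nfus1 _ _ _ x z) // (@Nfus1 _ _ _ y z) // !big_ord1.
move=> /(_ isT isT isT isT).
rewrite (sum_fuse (Nfus_act (sector (val z)) x y)); first by rewrite act_val Nfus1.
move=> n1; rewrite sum_ord1; first by rewrite act_val Nfus1.
move=> n2; rewrite sum_ord1; first by rewrite Nfus1.
move=> n3; rewrite sum_ord1; first by rewrite Nfus1.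
by move=> n4 /=; rewrite -!val_mulg !act_val !FabE ?RabelE ?UabE.
Qed.

Lemma Rinv_val x y z : z = (x * y)%g ->
  Rinv (val x) (val y) (val z) 0 0 = (Rabel x y)^-1.
Proof. by move=> ->; have [_ <- _] := unit_conj (Rabel_unit x y). Qed.

Lemma Fab_heptagon2 x y z :
  (Rabel z x)^-1 * Fab x z y * (Rabel z y)^-1
  = Fab z x y * etaab z (secab x) (secab y) * (Rabel z (x * y)%g)^-1 *
    Fab x y z.
Proof.
have := @heptagon2P _ _ C (val x) (val y) (val z) (val (x * y * z)%g)
  (val (x * z)%g) (val (y * z)%g) 0%N 0%N 0%N 0%N.
rewrite /= -!val_mulg !act_val.
have e1 : (x * z = z * x)%g by [].
have e2 : (x * y * z = x * z * y)%g by rewrite -mulgA (xC y) mulgA.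
have e3 : (x * y * z = z * x * y)%g by rewrite -xC mulgA.
rewrite (Nfus1 e1) (Nfus1 e2) (Nfus1 (esym (mulgA x y z))).
rewrite (@Nfus1 _ _ _ x z) // (@Nfus1 _ _ _ y z) // (Nfus1 (xC y z)) !big_ord1.
move=> /(_ isT isT isT isT).
rewrite (sum_fuse (Nfus_val x y)); first by rewrite Nfus1.
move=> n1; rewrite sum_ord1; first by rewrite Nfus1 // -xC.
move=> n2; rewrite sum_ord1; first by rewrite Nfus1.
by move=> n3 /=; rewrite -!val_mulg !FabE ?Rinv_val // -xC.
Qed.

Lemma etaab_cocycle x u v w :
  etaab x u v * etaab x (u * v)%g w = etaab x v w * etaab x u (v * w)%g.
Proof. by have := @eta_cocycleP _ _ C (val x) u v w; rewrite act_val. Qed.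

Lemma Uab_etaab u v x y :
  etaab x u v * etaab y u v * (Uab v x y * Uab u x y)
  = Uab (u * v)%g x y * etaab (x * y)%g u v.
Proof.
have := @U_etaP _ _ C u v (val x) (val y) (val (x * y)%g) 0%N 0%N.
by rewrite !act_val Nfus1 // big_ord1 => /(_ isT isT).
Qed.

Lemma Rabel_ribbon x y :
  Rabel y x * Rabel x y
  = Rabel (x * y)%g (x * y)%g / (Rabel x x * Rabel y y) *
    (Uab (secab x * secab y)%g x y /
     (etaab x (secab x) (secab y) *
      etaab y (secab y) ((secab y)^-1 * secab x * secab y)%g)).
Proof.
have := @ribbonP _ _ C (val x) (val y) (val (x * y)%g) 0%N 0%N.
rewrite /= -val_mulg !act_val Nfus1 // (Nfus1 (xC x y)) big_ord1 !theta_val.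
by move=> /(_ isT isT); rewrite (RabelE (xC x y)).
Qed.

Lemma Fab1l x y : Fab 1%g x y = 1.
Proof.
have [F1 _] := normalizationP C.
have := F1 (val x) (val y) (val (x * y)%g) 0%N 0%N; rewrite Nfus1 //.
by rewrite -val_oneg FabE ?mul1g // => ->.
Qed.

Lemma Fab1m x y : Fab x 1%g y = 1.
Proof.
have [_ [F1 _]] := normalizationP C.
have := F1 (val x) (val y) (val (x * y)%g) 0%N 0%N; rewrite Nfus1 //.
by rewrite -val_oneg FabE ?mulg1 ?mul1g // => ->.
Qed.

Lemma Fab1r x y : Fab x y 1%g = 1.
Proof.
have [_ [_ [F1 _]]] := normalizationP C.
have := F1 (val x) (val y) (val (x * y)%g) 0%N 0%N; rewrite Nfus1 //.
by rewrite -val_oneg FabE ?mulg1 // => ->.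
Qed.

Lemma Rabel1l x : Rabel 1%g x = 1.
Proof.
have [_ [_ [_ [R1 _]]]] := normalizationP C.
by have [_] := R1 (val x); rewrite -val_oneg RabelE ?mul1g.
Qed.

Lemma Rabel1r x : Rabel x 1%g = 1.
Proof.
have [_ [_ [_ [R1 _]]]] := normalizationP C.
by have [+ _] := R1 (val x); rewrite -val_oneg RabelE ?mulg1.
Qed.

Lemma Uab1 x y : Uab 1%g x y = 1.
Proof.
have [_ [_ [_ [_ [_ [U1 _]]]]]] := normalizationP C.
by rewrite /Uab U1 ?Nfus1.
Qed.

Lemma etaab1 x u : etaab x u 1%g = 1 /\ etaab x 1%g u = 1.
Proof. by have [_ [_ [_ [_ [_ [_ [_ e1]]]]]]] := normalizationP C; apply: e1. Qed.

Lemma Mab_val x y : Mab (val x) (val y) = Rabel x y * Rabel y x.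
Proof. by []. Qed.

Lemma norm_Mab x y : `|Mab (val x) (val y)| = 1.
Proof.
rewrite Mab_val normrM.
have [_ _ ->] := unit_conj (Rabel_unit x y).
by have [_ _ ->] := unit_conj (Rabel_unit y x); rewrite mulr1.
Qed.

Lemma norm_Iinv n x : `|Iinv n (val x)| = 1.
Proof.
rewrite /Iinv normrM normrX theta_val.
have [_ _ ->] := unit_conj (Rabel_unit x x); rewrite expr1n mul1r normr_prod.
by have [_ [_ [_ eU]]] := unitarityP C; rewrite big1.
Qed.

Lemma Iinv_val n x : Iinv n (val x) = inv_theta (@secab) Rabel etaab n x.
Proof. by rewrite /Iinv theta_val. Qed.

Lemma Iinv_mulg x y m n : (secab x ^+ m = 1)%g -> (secab y ^+ n = 1)%g ->
  Iinv (m * n) (val (x * y)%g)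
  = Mab (val (x ^+ m)%g) (val (y ^+ n)%g) *
    (Iinv (m * n) (val x) * Iinv (m * n) (val y)).
Proof.
move=> xm yn; rewrite !Iinv_val Mab_val.
have R0 a b : Rabel a b != 0 by have [] := unit_conj (Rabel_unit a b).
have U0 u a b : Uab u a b != 0 by have [] := unit_conj (Uab_unit u a b).
have e1l a u : etaab a 1%g u = 1 by have [] := etaab1 a u.
have e1r a u : etaab a u 1%g = 1 by have [] := etaab1 a u.
exact: (@inv_theta_mul _ _ _ (@secab) (@Fab) (@Rabel) (@Uab) (@etaab) xC
  (@sector_mul _ _ C) Fab_neq0 R0 U0 etaab_neq0 Fab_pentagon Fab1l Fab1m Fab1r
  Rabel1l Rabel1r Uab1 e1l e1r Fab_heptagon1 Fab_heptagon2 etaab_cocycle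
  Uab_etaab Rabel_ribbon x y m n xm yn).
Qed.

(** The [eta] factors have period [n] in [j]. This brings the three invariants of the theorem to the
    common index [m * n]. *)
Lemma Iinv_exp x n r : (secab x ^+ n = 1)%g ->
  Iinv (n * r) (val x) = Iinv n (val x) ^+ r.
Proof.
move=> xn; rewrite /Iinv exprMn exprM; congr (_ * _).
apply: (prod_periodic _ (f := fun j => etaab x (secab x) (secab x ^+ j)%g)).
by move=> j; rewrite expgD xn mul1g.
Qed.

End Symbols.

(** * The parametrization of the unit circle by [cis], and roots of phases *)

Section Cis.
Variable R : realType.
Implicit Types (x y t : R) (z w : R[i]).

Lemma cisD x y : cis (x + y) = cis x * cis y.
Proof.
rewrite /cis mulrDr cosD sinD; apply/eqP; rewrite eq_complex /=.
by apply/andP; split; apply/eqP; ring.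
Qed.

Lemma cis1 : cis (1 : R) = 1.
Proof. by rewrite /cis mulr1 mulr_natl cos2pi sin2pi. Qed.

Lemma cis0 : cis (0 : R) = 1.
Proof. by rewrite /cis mulr0 cos0 sin0. Qed.

Lemma cisX n x : cis (n%:R * x) = cis x ^+ n.
Proof.
elim: n => [|n IHn]; first by rewrite mul0r cis0.
by rewrite exprS -IHn -cisD -addn1 natrD mulrDl mul1r addrC.
Qed.

Lemma cis_neq0 x : cis x != 0.
Proof.
apply/eqP => x0; have := cisD x (- x).
by rewrite subrr cis0 x0 mul0r => /eqP; rewrite oner_eq0.
Qed.

(** From the real part: cos(2 pi x) = 1 forces sin(pi x) = 0, whereas this sine is positive for 0 <
    x < 1. *)
Lemma cis_eq1 x : 0 <= x < 1 -> cis x = 1 -> x = 0.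
Proof.
move=> /andP[x0 x1] [cx _]; apply/eqP; move: x0; rewrite le_eqVlt.
case/predU1P => [->//|x0].
have s0 : 0 < sin (pi * x).
  by apply: sin_gt0_pi; rewrite mulr_gt0 ?pi_gt0 //= gtr_pMr ?pi_gt0.
have : sin (pi * x) ^+ 2 = 0.
  move: cx; rewrite (_ : 2 * pi * x = (pi * x) *+ 2); last first.
    by rewrite -[RHS]mulr_natl mulrA.
  by rewrite cos_mulr2n sin2cos2; lra.
by move/eqP; rewrite expf_eq0 /= (gt_eqF s0).
Qed.

Lemma cis_inj x y : 0 <= x < 1 -> 0 <= y < 1 -> cis x = cis y -> x = y.
Proof.
wlog xy : x y / x <= y.
  move=> wl hx hy e; have [|/ltW] := leP x y => h; first exact: wl.
  by apply/esym/wl.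
move=> /andP[x0 x1] /andP[y0 y1] e.
have d1 : cis (y - x) = 1.
  by apply: (mulfI (cis_neq0 x)); rewrite -cisD mulr1 e subrKC.
suff : y - x = 0 by lra.
by apply: cis_eq1 => //; lra.
Qed.

Lemma cis_surj z : `|z| = 1 -> exists x, 0 <= x < 1 /\ cis x = z.
Proof.
case: z => a b ab1.
have {ab1} ab1 : a ^+ 2 + b ^+ 2 = 1.
  have := add_Re2_Im2 (a +i* b)%C; rewrite ab1 expr1n /=.
  by case.
have a1 : -1 <= a <= 1.
  by have b2 := sqr_ge0 b; apply/andP; split; nra.
have pi0 := @pi_gt0 R; have pi1 : 2 * pi != 0 :> R by rewrite gt_eqF // mulr_gt0.
have sb : sin (acos a) = `|b|.
  by rewrite sin_acos // -ab1 addrC addKr sqrtr_sqr.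
have lt2pi : acos a < 2 * pi by apply: le_lt_trans (acos_lepi a1) _; lra.
have tlt : acos a / (2 * pi) < 1 by rewrite ltr_pdivrMr ?mul1r ?mulr_gt0.
have [b0|b0] := leP 0 b.
  exists (acos a / (2 * pi)); split.
    by rewrite divr_ge0 ?acos_ge0 ?mulr_ge0 ?pi_ge0.
  rewrite /cis (_ : 2 * pi * _ = acos a); last by rewrite mulrC divfK.
  by rewrite acosK ?in_itv //= sb ger0_norm.
(* At [a = 1] the witness below would be 1, outside the half-open interval; but there [b] would be
   0. *)
have a1' : a < 1.
  have [_ ale] := andP a1; rewrite lt_neqAle ale andbT; apply/eqP => aE.
  by move: ab1 b0; rewrite aE; nra.
have tgt : 0 < acos a / (2 * pi).
  by rewrite divr_gt0 ?mulr_gt0 // acos_gt0 // a1' andbT; case/andP: a1.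
(* On the lower half circle the angle is [- acos a], shifted by a full turn into the interval. *)
exists (1 - acos a / (2 * pi)); split; first lra.
rewrite cisD cis1 mul1r /cis (_ : 2 * pi * _ = - acos a); last first.
  by rewrite mulrN mulrC divfK.
by rewrite cosN sinN acosK ?in_itv //= sb ltr0_norm // opprK.
Qed.

(** Write [z = cis t] with [t] in [0,1). Then [cis (l t) = cis x], so [x] is the fractional part of
    [l t] by [cis_inj], and [k] is its integer part, less than [l]. *)
Lemma cis_root (l : nat) x z : (0 < l)%N -> 0 <= x < 1 ->
  `|z| = 1 -> z ^+ l = cis x -> exists k : 'I_l, z = cis ((x + k%:R) / l%:R).
Proof.
move=> l0 x01 /cis_surj[t [/andP[t0 t1] <-]] e.
have lR : (0 : R) < l%:R by rewrite ltr0n.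
have lt0 : 0 <= l%:R * t by rewrite mulr_ge0 // ltW.
have /andP[k1 k2] := truncn_itv lt0; set k := Num.truncn _ in k1 k2.
have kl : (k < l)%N.
  by rewrite -(ltr_nat R) (le_lt_trans k1) // gtr_pMr.
exists (Ordinal kl); congr cis => /=.
suff <- : l%:R * t - k%:R = x by rewrite subrK mulrC mulKf ?gt_eqF.
apply: cis_inj => //; first by rewrite -natr1 in k2; lra.
have {1}-> : l%:R * t - k%:R = - (k%:R * 1) + l%:R * t by ring.
rewrite cisD -e -cisX; apply: (mulfI (cis_neq0 (k%:R * 1))).
by rewrite mulrA -cisD subrr cis0 mul1r (cisX k 1) cis1 expr1n mul1r.
Qed.

End Cis.

(** For a phase, [cis_surj] provides a solution, so the default value 0 of [xget] plays no part in
    [pstar]. *)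
Lemma pstarP (R : realType) (G : finGroupType) (C : gcrossedBTC R G) (a b : C) :
  `|Mab a b| = 1 -> 0 <= pstar a b < 1 /\ cis (pstar a b) = Mab a b.
Proof. by move=> /cis_surj/(xgetPex 0). Qed.

(** * The power identity and the root formula for [T] *)

Theorem mainTheorem8 (R : realType) (m n : nat) (Hm : (0 < m)%N)
    (Hn : (0 < n)%N)
    (Zm Zn : finGroupType) (h : Zm) (g : Zn)
    (Zm_gen : <[h]>%g = [set: Zm]) (h_order : #[h]%g = m)
    (Zn_gen : <[g]>%g = [set: Zn]) (g_order : #[g]%g = n)
    (C : gcrossedBTC R (Zm * Zn)%type)
    (C_noperm : no_permutation C)
    (C_nomixed : no_mixed_fractionalization C)
    (og oh ogh : C)
    (og_ab : abelian_defect (1%g, g) og)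
    (oh_ab : abelian_defect (h, 1%g) oh)
    (ogh_ab : abelian_defect (h, g) ogh)
    (og_oh : fuse og oh = ogh) :
  let l := gcdn m n in
  let L := lcmn m n in
  let p := fuse_pow og n in
  let q := fuse_pow oh m in
  let T := Iinv L ogh / (Iinv m oh ^+ (n %/ l) * Iinv n og ^+ (m %/ l)) in
  T ^+ L = Mab p q ^+ (L %/ l) /\
  exists k : 'I_l, T = cis ((pstar p q + k%:R) / l%:R).
Proof.
move=> l L p q T.
have [sg /eqP dg] := og_ab; have [sh /eqP dh] := oh_ab; have [sgh _] := ogh_ab.
pose x : abobj C := Sub og dg; pose y : abobj C := Sub oh dh.
have xC := abobj_comm Zm_gen Zn_gen C_noperm C_nomixed.
have act := bact_val Zm_gen Zn_gen C_noperm C_nomixed.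
have hm : (h ^+ m = 1)%g by rewrite -h_order expg_order.
have gn : (g ^+ n = 1)%g by rewrite -g_order expg_order.
have hL : (h ^+ L = 1)%g.
  by rewrite /L; have /dvdnP[i ->] := dvdn_lcml m n; rewrite mulnC expgM hm expg1n.
have gL : (g ^+ L = 1)%g.
  by rewrite /L; have /dvdnP[i ->] := dvdn_lcmr m n; rewrite mulnC expgM gn expg1n.
have pairX (u : Zm) (v : Zn) k : ((u, v) ^+ k = (u ^+ k, v ^+ k))%g.
  by elim: k => // k IHk; rewrite !expgS IHk.
have xn : (secab x ^+ n = 1)%g by rewrite /secab sg pairX expg1n gn.
have ym : (secab y ^+ m = 1)%g by rewrite /secab sh pairX expg1n hm.
have xyE : val (x * y)%g = ogh by rewrite val_mulg og_oh.
have xyL : (secab (x * y)%g ^+ L = 1)%g by rewrite /secab xyE sgh pairX hL gL.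
have pE : p = val (x ^+ n)%g by rewrite val_expg.
have qE : q = val (y ^+ m)%g by rewrite val_expg.
have M1 : `|Mab p q| = 1 by rewrite pE qE norm_Mab.
have l0 : (0 < l)%N by rewrite gcdn_gt0 Hm.
have Inz k z : Iinv k (val (z : abobj C)) != 0.
  by rewrite -normr_eq0 norm_Iinv // oner_eq0.
have T1 : `|T| = 1.
  have N := norm_Iinv xC act.
  rewrite /T -xyE -[og]/(val x) -[oh]/(val y) normf_div N.
  by rewrite (normrM (Iinv m _ ^+ _)) !normrX !N !expr1n mulr1 divr1.
(* The [l]-th power turns the exponents [n %/ l] and [m %/ l] into [n] and [m]. Since
   [L * l = m * n], all three invariants then have index [m * n], and [Iinv_mulg] applies. *)
have Tl : T ^+ l = Mab p q.
  have E (a b c : R[i]) i j :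
      (a / (b ^+ i * c ^+ j)) ^+ l = a ^+ l / (b ^+ (i * l) * c ^+ (j * l)).
    by rewrite expr_div_n exprMn -!exprM.
  rewrite /T E !divnK ?dvdn_gcdl ?dvdn_gcdr //.
  rewrite -xyE -[og]/(val x) -[oh]/(val y).
  rewrite -(Iinv_exp l xyL) -(Iinv_exp n ym) -(Iinv_exp m xn).
  rewrite -[(L * l)%N]/(lcmn m n * gcdn m n)%N muln_lcm_gcd mulnC.
  rewrite (Iinv_mulg xC act xn ym) -pE -qE [Iinv _ (val x) * _]mulrC mulfK //.
  by rewrite mulf_neq0.
split; last first.
  by have [p01 psE] := pstarP M1; apply: cis_root => //; rewrite psE.
(* [T ^+ L] is the [L %/ l]-th power of [T ^+ l]; the division is exact because [l] divides [m],
   which divides [L]. *)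
rewrite -Tl -exprM mulnC divnK //.
by apply: dvdn_trans (dvdn_gcdl m n) (dvdn_lcml m n).
Qed.
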